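(* Every oriented star is $\chi$-bounding. That is, for every oriented graph $H$ whose underlying graph is isomorphic to $K_{1,t}$ for some $t\ge 0$ (with edges oriented arbitrarily), there is a function $f$ such that $\chi(G)\le f(\omega(G))$ for every oriented graph $G$ not containing $H$ as an induced subdigraph.
   Context: All graphs are finite and simple. A digraph (oriented graph) has no loops, no parallel edges and no pair of antiparallel edges. For a digraph $G$, $G^*$ is its underlying undirected graph, and $\chi(G)$, $\omega(G)$ denote the chromatic number and clique number of $G^*$. An oriented graph $H$ is $\chi$-bounding if there is a function $f$ such that $\chi(G)\le f(\omega(G))$ for every oriented graph $G$ not containing $H$ as an induced subdigraph. *)

(* Defs.v *)
From mathcomp Require Import all_boot.
Set Implicit Arguments. Unset Strict Implicit. Unset Printing Implicit Defensive.

Definition oriented (T : finType) (a : rel T) : Prop :=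
  (forall x, ~~ a x x) /\ (forall x y, a x y -> ~~ a y x).

Definition und (T : finType) (a : rel T) : rel T := fun x y => a x y || a y x.

Definition proper_col (T : finType) (a : rel T) (k : nat) (c : {ffun T -> 'I_k}) : bool :=
  [forall x, forall y, und a x y ==> (c x != c y)].

(* chi(G): least k such that G^* has a proper k-colouring
   (k = #|T| always works, so the search over 0..#|T| finds it). *)
Definition chi (T : finType) (a : rel T) : nat :=
  find (fun k => [exists c : {ffun T -> 'I_k}, proper_col a c]) (iota 0 #|T|.+1).

Definition clique (T : finType) (a : rel T) (S : {set T}) : bool :=
  [forall x in S, forall y in S, (x != y) ==> und a x y].

Definition omega (T : finType) (a : rel T) : nat :=
  \max_(S : {set T} | clique a S) #|S|.

Definition induced_sub (TH TG : finType) (aH : rel TH) (aG : rel TG) : Prop :=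
  exists h : TH -> TG, injective h /\ forall x y, aG (h x) (h y) = aH x y.

Definition star_rel (t : nat) : rel (option 'I_t) := fun x y =>
  match x, y with
  | None, Some _ | Some _, None => true
  | _, _ => false
  end.

Definition oriented_star (TH : finType) (aH : rel TH) : Prop :=
  oriented aH /\
  exists t : nat, exists phi : TH -> option 'I_t,
    bijective phi /\ forall x y, und aH x y = star_rel (phi x) (phi y).

(* Main.v *)
(** Proof idea. If [G] omits the star, then for any [x] and any bounded set [Q]
    of in-neighbours of [x], all but boundedly many out-neighbours of [x] are
    adjacent to all but boundedly many vertices of [Q]: otherwise Ramsey and
    pigeonhole give a star at [x]. Exceptional pairs form a digraph of bounded
    outdegree, so up to a bounded partition there are none.

    Induct on the clique number, so that neighbourhoods have bounded chromatic
    number. Remove [n] disjoint stable sets [V_i] so that every remaining vertex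
    has a neighbour in each [V_i], and let [h_i(x)] be the first one in a fixed
    order. After a bounded partition, and up to reversing all edges, [h_i(x)] is
    an in-neighbour of [x] for many fixed [i]. If [x -> y] then [y] is adjacent
    to [h_i(x)], whence [h_i(y) <= h_i(x)], for all but boundedly many [i]. Edges
    with [h_i(x) = h_i(y)] for some [i] lie inside neighbourhoods; along the
    remaining edges [h_i] strictly decreases for almost all [i], so they close no
    short directed cycle. Sampling in-neighbours repeatedly then grows transitive
    chains of these edges into cliques, unless they have bounded chromatic
    number. *)

Require Import Defs.
From mathcomp Require Import all_boot.
From mathcomp Require Import zify.

Set Implicit Arguments. Unset Strict Implicit. Unset Printing Implicit Defensive.

(** * Colourings and Ramsey *)

Definition colorable (T : finType) (r : rel T) (k : nat) : Prop :=
  exists c : T -> 'I_k, forall x y, r x y -> c x != c y.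

Lemma colorable_by (T C : finType) (r : rel T) (k : nat) (c : T -> C) :
  #|C| <= k -> (forall x y, r x y -> c x != c y) -> colorable r k.
Proof.
move=> leCk cP; exists (fun x => widen_ord leCk (enum_rank (c x))) => x y rxy.
apply: contra (cP x y rxy) => /eqP /(congr1 val) /= e.
by apply/eqP/enum_rank_inj/val_inj.
Qed.

Lemma colorable_sub (T : finType) (r r' : rel T) (k k' : nat) :
  subrel r r' -> k <= k' -> colorable r' k -> colorable r k'.
Proof.
move=> sub lek [c cP]; apply: (@colorable_by _ _ _ _ c); first by rewrite card_ord.
by move=> x y /sub /cP.
Qed.

Lemma colorable_union (T : finType) (r r' : rel T) (k k' : nat) :
  colorable r k -> colorable r' k' -> colorable (relU r r') (k * k').
Proof.
move=> [c cP] [c' cP']; apply: (@colorable_by _ _ _ _ (fun x => (c x, c' x))).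
  by rewrite card_prod !card_ord.
by move=> x y /orP[/cP|/cP']; apply: contra_neq => -[].
Qed.

(** Edges between different fibres are ignored, so all fibres share one palette. *)
Lemma colorable_fibers (T I : finType) (r : rel T) (s : T -> I) (k : nat) :
  (forall i, colorable (fun x y => [&& s x == i, s y == i & r x y]) k) ->
  colorable (fun x y => (s x == s y) && r x y) k.
Proof.
move=> /fin_all_exists [c cP]; exists (fun x => c (s x) x) => x y /andP[/eqP e rxy].
by rewrite -e; apply: cP; rewrite e eqxx rxy.
Qed.

Lemma colorable_partition (T I : finType) (r : rel T) (s : T -> I) (k : nat) :
  (forall i, colorable (fun x y => [&& s x == i, s y == i & r x y]) k) ->
  colorable r (#|I| * k).
Proof.
move=> /colorable_fibers ck.
have cs : colorable (fun x y => s x != s y) #|I| by apply: (@colorable_by _ _ _ _ s).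
apply: colorable_sub (colorable_union cs ck) => // x y rxy /=.
by rewrite rxy andbT orNb.
Qed.

Lemma colorable_bigunion (T J : finType) (r : J -> rel T) (k : nat) :
  (forall j, colorable (r j) k) ->
  colorable (fun x y => [exists j, r j x y]) (k ^ #|J|).
Proof.
move=> /fin_all_exists [c cP].
apply: (@colorable_by _ _ _ _ (fun x => [ffun j => c j x])).
  by rewrite card_ffun card_ord.
move=> x y /existsP[j /cP]; apply: contra_neq => /ffunP /(_ j).
by rewrite !ffunE.
Qed.

(** Degeneracy: by averaging, every vertex set contains a vertex with at most [d] in-neighbours in
    it, and this vertex sees at most [2 * d] colours on the rest. *)
Lemma colorable_outdegree (T : finType) (out : T -> {set T}) (d : nat) :
  (forall x, #|out x| <= d) ->
  colorable (fun x y => (x != y) && (y \in out x)) (d.*2).+1.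
Proof.
move=> out_d.
suff H n : forall S : {set T}, #|S| = n -> exists c : T -> 'I_(d.*2).+1,
    forall x y, x \in S -> y \in S -> x != y -> y \in out x -> c x != c y.
  have [c cP] := H _ [set: T] erefl; exists c => x y /andP[xy yx].
  by apply: cP; rewrite ?inE.
elim: n => [|n IHn] S cardS.
  by exists (fun=> ord0) => x y; rewrite (cards0_eq cardS) inE.
have [x xS inx] : exists2 x, x \in S & #|[set y in S | x \in out y]| <= d.
  apply/exists_inP; apply: contraT; rewrite negb_exists_in => /forall_inP big.
  suff : \sum_(x in S) d.+1 <= \sum_(y in S) d.
    by rewrite !sum_nat_const cardS; lia.
  apply: (@leq_trans (\sum_(x in S) #|[set y in S | x \in out y]|)).
    by apply: leq_sum => x /big; rewrite ltnNge.
  under eq_bigr => x _ do rewrite -sum1dep_card big_mkcondr /=.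
  rewrite exchange_big /=; apply: leq_sum => y _.
  rewrite -big_mkcondr sum1dep_card; apply: leq_trans (out_d y).
  by apply/subset_leq_card/subsetP => x; rewrite inE => /andP[].
have [|c cP] := IHn (S :\ x); first by rewrite (cardsD1 x) xS in cardS; case: cardS.
pose nb := [set y in S | x \in out y] :|: out x.
have nb_small : #|c @: nb| < #|'I_(d.*2).+1|.
  rewrite card_ord ltnS; apply: leq_trans (leq_imset_card _ _) _.
  apply: leq_trans (leq_card_setU _ _) _.
  by rewrite -addnn leq_add.
have [col colP] : exists col, col \notin c @: nb.
  apply/existsP; apply: contraTT nb_small; rewrite negb_exists -leqNgt => /forallP H.
  by apply/subset_leq_card/subsetP => i _; have := H i; rewrite negbK.
exists (fun y => if y == x then col else c y) => y z yS zS yz zy.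
case: (eqVneq y x) => [ey|yx]; case: (eqVneq z x) => [ez|zx].
- by rewrite ey ez eqxx in yz.
- apply: contraNneq colP => ->; apply: imset_f.
  by rewrite !inE -ey zy orbT.
- apply: contraNneq colP => <-; apply: imset_f.
  by rewrite !inE -ez yS zy.
by apply: cP; rewrite ?inE ?yx ?zx.
Qed.

Lemma ramsey (T : finType) (e : rel T) (a b : nat) (S : {set T}) :
  symmetric e -> 2 ^ (a + b) <= #|S| ->
  (exists A : {set T}, [/\ A \subset S, #|A| = a &
     forall x y, x \in A -> y \in A -> x != y -> e x y]) \/
  (exists B : {set T}, [/\ B \subset S, #|B| = b &
     forall x y, x \in B -> y \in B -> x != y -> ~~ e x y]).
Proof.
move=> sym; have [n] := ubnP (a + b); elim: n a b S => // n IHn a b S.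
case: a => [|a].
  by left; exists set0; split; rewrite ?sub0set ?cards0 // => x y; rewrite inE.
case: b => [|b].
  by right; exists set0; split; rewrite ?sub0set ?cards0 // => x y; rewrite inE.
rewrite ltnS => leabn bigS.
have /card_gt0P [x xS] : 0 < #|S| by apply: leq_trans bigS; rewrite expn_gt0.
pose N := [set y in S :\ x | e x y]; pose M := [set y in S :\ x | ~~ e x y].
have cSx : #|S| = (#|N| + #|M|).+1.
  rewrite (cardsD1 x) xS add1n -(cardsID [set y | e x y] (S :\ x)).
  by congr (_ + _).+1; apply: eq_card => y; rewrite !inE // andbC.
have extend (P : rel T) (A : {set T}) (c : nat) :
    symmetric P -> A \subset [set y in S :\ x | P x y] -> #|A| = c ->
    (forall x y, x \in A -> y \in A -> x != y -> P x y) ->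
    exists A : {set T}, [/\ A \subset S, #|A| = c.+1 &
     forall x y, x \in A -> y \in A -> x != y -> P x y].
  move=> symP /subsetP sA cA AP; exists (x |: A); split.
  - apply/subsetP => y; rewrite !inE => /orP[/eqP->//|/sA].
    by rewrite !inE => /andP[/andP[]].
  - rewrite cardsU1 cA; case: (boolP (x \in A)) => // /sA.
    by rewrite !inE eqxx.
  move=> y z; rewrite !inE => /orP[/eqP->|yA] /orP[/eqP->|zA]; rewrite ?eqxx //.
  - by move=> _; have := sA _ zA; rewrite !inE => /andP[].
  - by move=> _; have := sA _ yA; rewrite symP !inE => /andP[].
  exact: AP.
have symN : symmetric (fun x y => ~~ e x y) by move=> y z; rewrite sym.
have sNS : N \subset S by apply/subsetP => y; rewrite !inE => /andP[/andP[]].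
have sMS : M \subset S by apply/subsetP => y; rewrite !inE => /andP[/andP[]].
(* Each bound is half of [2 ^ (a.+1 + b.+1)]; if both failed, [S] would be too small even counting
   [x]. *)
have [bigN|bigM] : 2 ^ (a + b.+1) <= #|N| \/ 2 ^ (a.+1 + b) <= #|M|.
  move: bigS; rewrite cSx !addnS !addSn !expnS.
  by move: (2 ^ (a + b)) => u; lia.
- have [|//|[A [sA cA AP]]|[B [sB cB BP]]] := IHn a b.+1 N; first by lia.
  + by left; apply: (extend e A).
  + by right; exists B; split => //; apply: subset_trans sNS.
- have [|//|[A [sA cA AP]]|[B [sB cB BP]]] := IHn a.+1 b M; first by lia.
  + by left; exists A; split => //; apply: subset_trans sMS.
  + by right; apply: (extend (fun x y => ~~ e x y) B).
Qed.

(** * Graphs without a star *)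

Lemma card_has (I : Type) (T : finType) (A : I -> pred T) (m : nat) (s : seq I) :
  all (fun i => #|[set z | A i z]| <= m) s ->
  #|[set z | has (A^~ z) s]| <= size s * m.
Proof.
elim: s => [_|i s IHs /andP[Ai /IHs As]] /=.
  by rewrite leqn0 cards_eq0; apply/eqP/setP => z; rewrite !inE.
apply: leq_trans (_ : #|[set z | A i z] :|: [set z | has (A^~ z) s]| <= _).
  by apply/subset_leq_card/subsetP => z; rewrite !inE.
by apply: leq_trans (leq_card_setU _ _) _; rewrite mulSn leq_add.
Qed.

Section StarFree.

Variables (T : finType) (a : rel T) (k t : nat).

(** One condition for all orientations: such a configuration contains every oriented star with at
    most [t] leaves. It is also invariant under reversing all edges. *)
Definition star_free : Prop := forall (x : T) (P Q : {set T}),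
  (forall y, y \in P -> a x y) -> (forall y, y \in Q -> a y x) ->
  t <= #|P| -> t <= #|Q| ->
  ~ (forall y z, y \in P :|: Q -> z \in P :|: Q -> ~~ und a y z).

Hypothesis a_oriented : oriented a.
Hypothesis a_star_free : star_free.
Hypothesis a_clique : forall S : {set T}, clique a S -> #|S| <= k.

Definition star_ramsey : nat := 2 ^ (k.+1 + t).

Lemma und_sym : symmetric (und a).
Proof. by move=> x y; rewrite /und orbC. Qed.

Lemma und_irr x : und a x x = false.
Proof. by rewrite /und (negPf (a_oriented.1 x)). Qed.

Lemma stable_subset (S : {set T}) : star_ramsey <= #|S| ->
  exists B : {set T}, [/\ B \subset S, #|B| = t &
    forall x y, x \in B -> y \in B -> ~~ und a x y].
Proof.
case/(ramsey und_sym) => [[A [_ cA AP]]|[B [sB cB BP]]].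
  suff /a_clique : clique a A by rewrite cA ltnn.
  apply/forall_inP => x xA; apply/forall_inP => y yA.
  by apply/implyP; apply: AP.
exists B; split=> // x y xB yB; have [->|] := eqVneq x y; first by rewrite und_irr.
exact: BP.
Qed.

Definition exceptional (x : T) (Q : {set T}) : {set T} :=
  [set y | a x y & star_ramsey <= #|[set z in Q | ~~ und a z y]|].

(** Pigeonhole on the missed subset [Q'] of [Q]: if [star_ramsey] exceptional vertices share it,
    Ramsey gives stable [t]-sets among them and inside [Q'], with no edges across, hence a star at
    [x]. *)
Lemma card_exceptional (x : T) (Q : {set T}) :
  (forall z, z \in Q -> a z x) -> #|exceptional x Q| <= 2 ^ #|Q| * star_ramsey.
Proof.
move=> Qx; pose miss y := [set z in Q | ~~ und a z y].
have [big|small] := boolP [exists Q' in powerset Q,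
    (star_ramsey <= #|[set y in exceptional x Q | miss y == Q']|)].
  have [Q' _ /stable_subset[P [sP cP stP]]] := exists_inP big.
  (* [P] is empty only if [t = 0], and then empty sets already contradict [star_free]. *)
  have [y yP|] := pickP (mem P); last first.
    move=> /eq_card0; rewrite cP => t0.
    by exfalso; apply: (a_star_free (x := x) (P := set0) (Q := set0));
      rewrite ?t0 // => y; [rewrite inE | rewrite inE | move=> z; rewrite !inE].
  have PE z : z \in P -> a x z /\ miss z = Q'.
    by move=> /(subsetP sP); rewrite !inE => /andP[/andP[-> _] /eqP].
  have bigQ' : star_ramsey <= #|Q'|.
    by rewrite -(PE y yP).2; move: yP => /(subsetP sP); rewrite !inE => /andP[/andP[]].
  have [Q'' [sQ'' cQ'' stQ'']] := stable_subset bigQ'.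
  have anti u z : u \in P -> z \in Q'' -> ~~ und a z u.
    by move=> /PE[_ mu] /(subsetP sQ''); rewrite -mu inE => /andP[].
  have Q''x z : z \in Q'' -> a z x.
    by move=> /(subsetP sQ''); rewrite -(PE y yP).2 inE => /andP[/Qx].
  exfalso; apply: (a_star_free (x := x) (P := P) (Q := Q'')); rewrite ?cP ?cQ'' //.
    by move=> u /PE[].
  move=> u z; rewrite !inE => /orP[uP|uQ] /orP[zP|zQ].
  - exact: stP.
  - by rewrite und_sym anti.
  - by rewrite anti.
  - exact: stQ''.
rewrite -sum1_card (partition_big miss (mem (powerset Q))) /=; last first.
  by move=> y _; rewrite powersetE; apply/subsetP => z; rewrite inE => /andP[].
rewrite -card_powerset -sum_nat_const; apply: leq_sum => Q' Q'P.
move: small; rewrite negb_exists_in => /forall_inP /(_ Q' Q'P); rewrite -ltnNge => /ltnW.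
by apply: leq_trans; rewrite sum1dep_card subset_leq_card //; apply/subsetP => y; rewrite !inE.
Qed.

Lemma pairwise_size (s : seq T) : pairwise a s -> size s <= k.
Proof.
move=> pws; have und_s x y : x \in s -> y \in s -> x != y -> und a x y.
  elim: s pws => //= z s IHs /andP[/allP az /IHs und_s].
  rewrite !inE => /orP[/eqP->|xs] /orP[/eqP->|ys]; rewrite ?eqxx //.
  - by rewrite /und (az _ ys).
  - by rewrite /und (az _ xs) orbT.
  exact: und_s.
have <- : #|[set x in s]| = size s.
  rewrite cardsE; apply/card_uniqP; apply: pairwise_uniq pws.
  by move=> x; apply/negbTE/a_oriented.1.
apply: a_clique; apply/forall_inP => x; rewrite inE => xs.
by apply/forall_inP => y; rewrite inE => ys; apply/implyP; apply: und_s.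
Qed.

(** * Growing chains into cliques *)

Section Chains.

Variable e : rel T.
Hypothesis e_sub : subrel e a.
(** Short paths suffice: the chains closed up below lie in cliques, up to one new vertex. *)
Hypothesis e_acyclic : forall (x : T) (s : seq T),
  path e x s -> size s <= k -> ~~ a (last x s) x.

(* Large enough that [k] vertices, each missing fewer than [star_ramsey] vertices
   of a sample, leave a common neighbour in it. *)
Definition sample_size : nat := (k * star_ramsey).+1.

(** The first summand bounds the exceptional set of a sample, the second an in-neighbourhood too
    small to be sampled. *)
Definition chain_degree : nat := 2 ^ sample_size * star_ramsey + sample_size.

(** Each of the [n] extension steps splits a class by a degeneracy colouring and by one bit. *)
Definition chain_colors (n : nat) : nat := ((chain_degree.*2).+1 * 2) ^ n.

(* Chains list their vertices from the source: all pairs are [a]-edges, and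
   consecutive ones are [e]-edges. The extension [u] may leave [W]. *)
Definition extendable (n : nat) (W : pred T) : Prop :=
  forall (x : T) (s : seq T), path e x s -> pairwise a (x :: s) -> all W (x :: s) ->
  exists u : seq T, [/\ size u = n, sorted e (u ++ x :: s) & pairwise a (u ++ x :: s)].

(* A class is split into vertices with few [e]-in-neighbours in it, and classes of
   the others without exceptional pairs for samples of these in-neighbours; the
   next source comes from the sample of the current one, and short acyclicity
   orients its edges. *)
Lemma extendable_partition (n : nat) :
  exists (C : finType) (f : T -> C), #|C| <= chain_colors n /\
  forall i, extendable n (fun x => f x == i) \/
            forall x y, f x = i -> f y = i -> ~~ e x y.
Proof.
elim: n => [|n [C [f [cardC fP]]]].
  exists unit, (fun=> tt); rewrite card_unit; split=> // i; left=> x s xs pxs _.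
  by exists [::].
pose inn x := [set z | e z x & f z == f x].
have [Q QP] : exists Q : T -> {set T}, forall x, sample_size <= #|inn x| ->
    Q x \subset inn x /\ #|Q x| = sample_size.
  apply: (@fin_all_exists _ (fun=> {set T}) (fun x A =>
    sample_size <= #|inn x| -> A \subset inn x /\ #|A| = sample_size)) => x.
  case: (leqP sample_size #|inn x|) => [|_]; last by exists set0.
  case/card_geqP => s [us ss sub]; exists [set z in s] => _; split.
    by apply/subsetP => z; rewrite inE => /sub.
  by rewrite cardsE; apply/eqP; rewrite -ss; apply/eqP/card_uniqP.
pose high x := sample_size <= #|inn x|.
(* One digraph serves both purposes: its colouring makes low classes [e]-stable and removes
   exceptional pairs from high ones. *)
pose out x := if high x then exceptional x (Q x) else inn x.
have [|c cP] := @colorable_outdegree T out chain_degree.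
  move=> x; rewrite /out; case: ifP => [/QP[sQ cQ]|].
    apply: leq_trans (leq_addr _ _); rewrite -cQ; apply: card_exceptional => z.
    by move=> /(subsetP sQ); rewrite inE => /andP[/e_sub].
  by rewrite /high => /negbT; rewrite -ltnNge => /ltnW /leq_trans; apply; apply: leq_addl.
exists (C * ('I_(chain_degree.*2).+1 * bool))%type, (fun x => (f x, (c x, high x))).
split.
  by rewrite !card_prod card_ord card_bool /chain_colors expnSr leq_mul.
case=> i [j []]; last first.
  right=> x y [fx cx hx] [fy cy hy]; apply/negP => exy.
  have xy : x != y by apply: contraL (e_sub exy) => /eqP->; apply: a_oriented.1.
  have /cP : (y != x) && (x \in out y).
    by rewrite eq_sym xy /out hy inE exy fx fy eqxx.
  by rewrite cx cy eqxx.
(* In an [e]-stable class no vertex is high, so the refined class is empty. *)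
case: (fP i) => [exti|stable_i]; last first.
  left=> x s _ _ /= /andP[/eqP[fx _ hx] _].
  suff : inn x = set0 by move=> inn0; move: hx; rewrite /high inn0 cards0.
  apply/setP => z; rewrite !inE; apply/negbTE/nandP.
  case: (eqVneq (f z) (f x)) => [fz|_]; [left | by right].
  by apply: stable_i; rewrite ?fz.
left=> x s xs /= /andP[ax pws] /andP[/eqP[fx cx hx] Ws].
have [sQ cQ] := QP x hx.
have size_s : (size s).+1 <= k by apply: (@pairwise_size (x :: s)); rewrite /= ax.
have missQ y : y \in s -> #|[set z in Q x | ~~ und a z y]| < star_ramsey.
  move=> ys; rewrite ltnNge; apply/negP => bigmiss.
  have axy := allP ax _ ys.
  have /cP : (x != y) && (y \in out x).
    rewrite /out hx inE axy bigmiss !andbT.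
    by apply: contraL axy => /eqP->; apply: a_oriented.1.
  by have /eqP[_ cy _] := allP Ws _ ys; rewrite cx cy eqxx.
have [z zQ zs] : exists2 z, z \in Q x & all (und a z) s.
  apply/exists_inP; apply: contraT; rewrite negb_exists_in => /forall_inP noz.
  suff : #|Q x| <= size s * star_ramsey.
    by rewrite cQ /sample_size; nia.
  suff sub : Q x \subset [set z | has (fun y => z \in [set z in Q x | ~~ und a z y]) s].
    apply: leq_trans (subset_leq_card sub) (card_has _).
    by apply/allP => y /missQ /ltnW; apply: leq_trans; apply: subset_leq_card;
      apply/subsetP => u; rewrite !inE.
  apply/subsetP => z zQ; rewrite inE; have /allPn[y ys zy] := noz z zQ.
  by apply/hasP; exists y => //; rewrite inE zQ.
have [ezx fz] : e z x /\ f z = f x.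
  by move: (subsetP sQ z zQ); rewrite inE => /andP[-> /eqP].
have az : all (a z) s.
  (* If the edge were [a y z], it would close the [e]-path from [z] through [x] to [y] into a short
     cycle. *)
  apply/allP => y ys; have /orP[//|ayz] := allP zs _ ys.
  case/splitPr: ys xs size_s => s1 s2.
  rewrite -cat_rcons cat_path size_cat size_rcons => /andP[xs1 _] size_s.
  have := @e_acyclic z (x :: rcons s1 y); rewrite /= ezx xs1 last_rcons size_rcons ayz.
  by move=> /(_ isT) H; suff : ~~ true by []; apply: H; lia.
(* [z] may leave the refined class but keeps its [f]-value, so the remaining [n] vertices come from
   the old partition. *)
have [|||u [su pu pwu]] := exti z (x :: s).
- by rewrite /= ezx.
- by rewrite /= e_sub // az ax.
- rewrite /= fz fx eqxx /=; apply/allP => y /(allP Ws) /eqP[-> _ _].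
  by rewrite eqxx.
by exists (rcons u z); rewrite size_rcons su cat_rcons.
Qed.

(** In an extendable class a single vertex would grow into a clique of size [k.+1], so nonempty
    classes are [e]-stable. *)
Lemma colorable_chains : colorable e (chain_colors k).
Proof.
have [C [f [cardC fP]]] := extendable_partition k.
apply: (@colorable_by _ _ _ _ f) => // x y exy; apply/eqP => fxy.
case: (fP (f x)) => [ext|stable_i]; last by have /negP := stable_i x y erefl (esym fxy).
have [|||u [su _ /pairwise_size]] := ext x [::] => //=.
  by rewrite eqxx.
by rewrite size_cat su /= addn1 ltnn.
Qed.

End Chains.

(** * Graphs whose chosen neighbours point inward *)

(** The factors deal with exceptional pairs, with edges whose ends share some [h i], and with the
    remaining edges. *)
Definition inward_colors (n tau : nat) : nat :=
  ((2 ^ n * star_ramsey).*2).+1 * (tau ^ n * chain_colors k).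

(* [rk] is the position in a linear order in which [h i x] is the first neighbour
   of [x] of kind [i]. *)
Lemma colorable_inward (J : finType) (I : {set J}) (h : J -> T -> T) (U : {set T})
    (rk : T -> nat) (tau : nat) :
  injective rk ->
  (forall i x, i \in I -> x \in U -> a (h i x) x) ->
  (forall x, x \in U -> {in I &, injective (h^~ x)}) ->
  (forall i x y, i \in I -> x \in U -> y \in U -> und a y (h i x) ->
    rk (h i y) <= rk (h i x)) ->
  (forall z, colorable (fun x y => [&& und a x z, und a y z & und a x y]) tau) ->
  k.+1 * star_ramsey <= #|I| ->
  colorable (fun x y => [&& x \in U, y \in U & und a x y]) (inward_colors #|J| tau).
Proof.
move=> rk_inj h_in h_inj h_min ctau bigI.
pose Q x := if x \in U then [set h i x | i in I] else set0.
have [|c cP] := @colorable_outdegree T (fun x => exceptional x (Q x)) (2 ^ #|J| * star_ramsey).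
  move=> x; apply: leq_trans (card_exceptional _) _.
    rewrite /Q; case: ifP => [xU z /imsetP[i iI ->]|_ z]; last by rewrite inE.
    exact: h_in.
  rewrite leq_mul2r leq_exp2l //; apply/orP; right; rewrite /Q; case: ifP => _.
    by apply: leq_trans (leq_imset_card _ _) (max_card _).
  by rewrite cards0.
rewrite /inward_colors -[X in X * _]card_ord.
apply: (@colorable_partition _ _ _ c) => j.
pose V := [pred x | (c x == j) && (x \in U)].
pose e := [rel x y | [&& V x, V y, a x y & ~~ [exists i in I, h i x == h i y]]].
(* For such [i], [h_min] makes [y] nonadjacent to [h i x]; many of these would make [y] exceptional
   for [x]. *)
have back_few x y : V x -> V y -> a x y ->
    #|[set i in I | rk (h i x) < rk (h i y)]| < star_ramsey.
  move=> /andP[/eqP cx xU] /andP[/eqP cy yU] axy; rewrite ltnNge; apply/negP => many.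
  have /cP : (x != y) && (y \in exceptional x (Q x)); last by rewrite cx cy eqxx.
  rewrite inE axy andTb; apply/andP; split.
    by apply: contraL axy => /eqP->; apply: a_oriented.1.
  apply: leq_trans many _; rewrite -(card_in_imset (f := h^~ x)); last first.
    by move=> i i'; rewrite !inE => /andP[iI _] /andP[i'I _]; apply: h_inj.
  apply/subset_leq_card/subsetP => z /imsetP[i]; rewrite inE => /andP[iI lti] ->.
  rewrite inE /Q xU imset_f //=; apply: contraL lti => adj.
  by rewrite -leqNgt h_min // und_sym.
(* Edges of [e] admit no ties, so the weak inequality is as rare as the strict one. *)
have edge_few x y : e x y ->
    #|[set i in I | rk (h i x) <= rk (h i y)]| <= star_ramsey.
  move=> /and4P[Vx Vy axy neq]; apply: leq_trans (ltnW (back_few x y Vx Vy axy)).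
  apply/subset_leq_card/subsetP => i; rewrite !inE => /andP[iI].
  rewrite iI leq_eqVlt => /orP[/eqP/rk_inj eqi|//].
  by case/negP: neq; apply/exists_inP; exists i => //; rewrite eqi.
(* An index that does not decrease along the whole path fails to decrease on one of its edges. *)
have path_few x y s : path e x (y :: s) -> V (last y s) /\
    #|[set i in I | rk (h i x) <= rk (h i (last y s))]| <= (size s).+1 * star_ramsey.
  elim: s x y => [|z s IHs] x y /= /andP[exy pys].
    by rewrite mul1n edge_few //; case/and4P: exy.
  have [Vl few] := IHs y z pys; split=> //.
  rewrite [(_.+2) * _]mulSn; apply: leq_trans (leq_add (edge_few _ _ exy) few).
  apply: leq_trans (leq_card_setU _ _).
  apply/subset_leq_card/subsetP => i; rewrite !inE => /andP[-> le_xs] /=.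
  by case: leqP => //= /ltnW /leq_trans; apply.
have colE : colorable e (chain_colors k).
  apply: colorable_chains; first by move=> x y /and4P[].
  move=> x [|y s] pxs size_s; first exact: a_oriented.1.
  apply/negP => /= alast.
  have Vx : V x by move: pxs => /andP[/and4P[]].
  have [Vlast few1] := path_few _ _ _ pxs.
  have few2 := back_few _ _ Vlast Vx alast.
  (* Every index fails on the path or on the closing edge. The latter is only an [a]-edge and may
     have ties, so the strict bound [back_few] is used there. *)
  suff : #|I| < k.+1 * star_ramsey by rewrite ltnNge bigI.
  apply: (@leq_ltn_trans (#|[set i in I | rk (h i x) <= rk (h i (last y s))]| +
     #|[set i in I | rk (h i (last y s)) < rk (h i x)]|)).
    apply: leq_trans (leq_card_setU _ _).
    apply/subset_leq_card/subsetP => i iI; rewrite !inE iI /=.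
    by case: leqP.
  rewrite mulSn addnC -addSn leq_add //; apply: leq_trans few1 _.
  by rewrite leq_mul2r size_s orbT.
have colEE : colorable (fun x y => e x y || e y x) (chain_colors k).
  have [c' c'P] := colE; exists c' => x y /orP[/c'P//|/c'P].
  by rewrite eq_sym.
have colI : colorable (fun x y => [exists i, (h i x == h i y) &&
    [&& i \in I, x \in U, y \in U & und a x y]]) (tau ^ #|J|).
  apply: colorable_bigunion => i; apply: colorable_fibers => z.
  apply: colorable_sub (ctau z) => // x y /and3P[/eqP hx /eqP hy /and4P[iI xU yU ->]].
  have xz : a z x by rewrite -hx h_in.
  have yz : a z y by rewrite -hy h_in.
  by rewrite /und xz yz !orbT.
apply: colorable_sub (colorable_union colI colEE) => // x y /and5P[cx cy xU yU xy] /=.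
case: (boolP [exists i in I, h i x == h i y]) => [/exists_inP[i iI hi]|neq].
  by apply/orP; left; apply/existsP; exists i; rewrite hi iI xU yU.
have neq' : ~~ [exists i in I, h i y == h i x].
  by apply: contra neq => /exists_inP[i iI hi]; apply/exists_inP; exists i; rewrite // eq_sym.
have [Vx Vy] : V x /\ V y by split; apply/andP.
by apply/orP; right; case/orP: xy => axy; apply/orP; [left | right]; apply/and4P.
Qed.

End StarFree.

(** * Edge reversal and one induction step *)

Lemma oriented_rev (T : finType) (a : rel T) : oriented a -> oriented (fun x y => a y x).
Proof. by case=> irr asym; split=> // x y; apply: asym. Qed.

Lemma star_free_rev (T : finType) (a : rel T) (t : nat) :
  star_free a t -> star_free (fun x y => a y x) t.
Proof.
move=> free x P Q aP aQ tP tQ st; apply: (free x Q P) => // y z yQP zQP.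
by rewrite /und orbC; apply: st; rewrite setUC.
Qed.

Lemma clique_rev (T : finType) (a : rel T) (S : {set T}) :
  clique (fun x y => a y x) S = clique a S.
Proof.
apply: eq_forallb_in => x xS; apply: eq_forallb_in => y yS.
by rewrite /und orbC.
Qed.

Lemma greedy_classes (T J : finType) (r : rel T) :
  symmetric r -> irreflexive r ->
  exists g : T -> option J,
    (forall x y, r x y -> g x = g y -> g x = None) /\
    (forall x i, g x = None -> exists2 y, g y = Some i & r x y).
Proof.
move=> sym irr.
pose proper (f : {ffun T -> option J}) :=
  [forall x, forall y, r x y ==> (f x == f y) ==> (f x == None)].
have proper0 : proper [ffun=> None].
  by apply/forallP => x; apply/forallP => y; rewrite !ffunE eqxx !implybT.
(* By minimality, a vertex without neighbour in class [i] is not left uncoloured. *)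
case: (arg_minnP (fun f : {ffun T -> option J} => #|[set x | f x == None]|) proper0).
move=> g /forallP gP g_min; exists g; split.
  move=> x y rxy gxy; apply/eqP; have /forallP/(_ y) := gP x.
  by rewrite rxy gxy eqxx.
move=> x i gx; suff /exists_inP[y /eqP gy rxy] : [exists y in [pred y | g y == Some i], r x y].
  by exists y.
apply: contraT; rewrite negb_exists_in => /forall_inP none.
pose g' := [ffun y => if y == x then Some i else g y].
have /g_min : proper g'.
  apply/forallP => y; apply/forallP => z; apply/implyP => ryz; rewrite !ffunE.
  case: (eqVneq y x) ryz => [->|yx]; case: (eqVneq z x) => [->|zx] //=; rewrite ?irr //.
  - move=> rxz; apply/implyP => /eqP gz.
    by have := none z; rewrite inE -gz eqxx rxz => /(_ isT).
  - move=> ryx; apply/implyP => gy.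
    by have := none y; rewrite inE gy sym ryx => /(_ isT).
  by move=> ryz; have /forallP/(_ z) := gP y; rewrite ryz.
suff : #|[set y | g' y == None]| < #|[set y | g y == None]| by rewrite ltnNge => /negP.
apply/proper_card/properP; split.
  by apply/subsetP => y; rewrite !inE ffunE; case: (eqVneq y x).
by exists x; rewrite !inE ?gx // ffunE eqxx.
Qed.

(** [n] is doubled so that half of the kinds point the same way. The factor [n.+1] colours by [g],
    and [2 ^ n] counts the direction patterns. *)
Definition step_colors (k t tau : nat) : nat :=
  let n := (k.+1 * star_ramsey k t).*2 in n.+1 * (2 ^ n * inward_colors k t n tau).

Lemma colorable_step (T : finType) (a : rel T) (k t tau : nat) :
  oriented a -> star_free a t -> (forall S : {set T}, clique a S -> #|S| <= k) ->
  (forall z, colorable (fun x y => [&& und a x z, und a y z & und a x y]) tau) ->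
  colorable (und a) (step_colors k t tau).
Proof.
move=> ori free cl ctau; rewrite /step_colors; set n := _.*2.
have [g [g_class g_dom]] :=
  @greedy_classes _ 'I_n _ (@und_sym _ a) (und_irr ori).
pose rk (x : T) : nat := enum_rank x.
have rk_inj : injective rk by move=> x y /val_inj/enum_rank_inj.
have [h hP] : exists h : 'I_n * T -> T, forall ix : 'I_n * T, g ix.2 = None ->
    [/\ g (h ix) = Some ix.1, und a ix.2 (h ix) &
        forall z, g z = Some ix.1 -> und a ix.2 z -> rk (h ix) <= rk z].
  apply: (@fin_all_exists _ (fun=> T) (fun (ix : 'I_n * T) y => g ix.2 = None ->
    [/\ g y = Some ix.1, und a ix.2 y &
        forall z, g z = Some ix.1 -> und a ix.2 z -> rk y <= rk z])) => -[i x] /=.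
  case: (boolP (g x == None)) => [/eqP gx|/eqP gx]; last by exists x.
  have [y0 gy0 xy0] := g_dom x i gx.
  have P0 : (g y0 == Some i) && und a x y0 by rewrite gy0 eqxx.
  case: (@arg_minnP _ y0 (fun y => (g y == Some i) && und a x y) rk P0).
  move=> y /andP[/eqP gy xy] ymin; exists y => _; split=> // z gz xz.
  by apply: ymin; rewrite gz eqxx.
(* The direction pattern of [x], made constant on [U] by the partition. *)
pose s x := [set i | a (h (i, x)) x].
have colg : colorable (fun x y => g x != g y) n.+1.
  by apply: (@colorable_by _ _ _ _ g) => //; rewrite card_option card_ord.
suff colN : colorable (fun x y => [&& g x == None, g y == None & und a x y])
    (2 ^ n * inward_colors k t n tau).
  apply: colorable_sub (colorable_union colg colN) => // x y xy /=.
  case: (eqVneq (g x) (g y)) => //= gxy; rewrite xy -gxy.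
  by rewrite (g_class x y xy gxy) eqxx.
have -> : 2 ^ n = #|{set 'I_n}| by rewrite -cardsT -powersetT card_powerset cardsT card_ord.
apply: (@colorable_partition _ _ _ s) => S.
pose U := [set x | (s x == S) && (g x == None)].
have h_inj x : x \in U -> injective (fun i => h (i, x)).
  rewrite inE => /andP[_ /eqP gx] i i' /(congr1 g).
  by have [-> _ _] := hP (i, x) gx; have [-> _ _] := hP (i', x) gx; case.
have h_min i x y : x \in U -> y \in U -> und a y (h (i, x)) ->
    rk (h (i, y)) <= rk (h (i, x)).
  rewrite !inE => /andP[_ /eqP gx] /andP[_ /eqP gy] yh.
  by have [_ _] := hP (i, y) gy; apply=> //; have [] := hP (i, x) gx.
have h_adj i x : x \in U -> und a x (h (i, x)).
  by rewrite inE => /andP[_ /eqP gx]; have [] := hP (i, x) gx.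
have in_S i x : x \in U -> (i \in S) = a (h (i, x)) x.
  by rewrite inE => /andP[/eqP<- _]; rewrite inE.
have -> : inward_colors k t n = inward_colors k t #|'I_n| by rewrite card_ord.
case: (leqP (k.+1 * star_ramsey k t) #|S|) => [bigS|smallS].
  have := @colorable_inward _ a k t ori free cl _ S (fun i x => h (i, x)) U rk tau.
  move=> /(_ rk_inj) inward; apply: colorable_sub (inward _ _ _ ctau bigS) => //.
  - by move=> x y /and5P[sx sy gx gy xy]; rewrite !inE sx sy gx gy.
  - by move=> i x iS xU; rewrite -in_S.
  - by move=> x xU; apply: in2W; apply: h_inj.
  by move=> i x y _; apply: h_min.
(* Most chosen neighbours are now out-neighbours; reversing all edges reduces to the inward case. *)
have bigS : k.+1 * star_ramsey k t <= #|~: S|.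
  by have := cardsC S; rewrite card_ord; move: smallS; rewrite /n; lia.
have := @colorable_inward _ _ k t (oriented_rev ori) (star_free_rev free) _ _ (~: S)
  (fun i x => h (i, x)) U rk tau.
have und_rev x y : und (fun x y => a y x) x y = und a x y by rewrite /und orbC.
move=> inward; apply: colorable_sub (inward _ rk_inj _ _ _ _ bigS) => //.
- by move=> x y /and5P[sx sy gx gy xy]; rewrite !inE sx sy gx gy und_rev.
- by move=> A; rewrite clique_rev; apply: cl.
- move=> i x; rewrite inE => iS xU; move: (h_adj i x xU).
  by rewrite /und -in_S // (negPf iS) orbF.
- by move=> x xU; apply: in2W; apply: h_inj.
- by move=> i x y _ xU yU; rewrite und_rev; apply: h_min.
by move=> z; apply: colorable_sub (ctau z) => // x y; rewrite !und_rev.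
Qed.

(** * Induction on the clique number *)

Lemma colorable_sig (T : finType) (P : pred T) (r : rel T) (k : nat) :
  colorable (fun u v : {x | P x} => r (val u) (val v)) k ->
  colorable (fun x y => [&& P x, P y & r x y]) k.+1.
Proof.
(* The extra colour [None] serves vertices outside [P], since ['I_k] may be empty. *)
move=> [c cP]; apply: (@colorable_by _ _ _ _ (fun x => omap c (insub x))).
  by rewrite card_option card_ord.
move=> x y /and3P[Px Py rxy]; rewrite !insubT /=.
by apply: contra_neq (cP (exist _ x Px) (exist _ y Py) rxy) => -[].
Qed.

Fixpoint star_chi_bound (t k : nat) : nat :=
  if k is k'.+1 then step_colors k t (star_chi_bound t k').+1 else 0.

Lemma colorable_star_free (t k : nat) (T : finType) (a : rel T) :
  oriented a -> star_free a t -> (forall S : {set T}, clique a S -> #|S| <= k) ->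
  colorable (und a) (star_chi_bound t k).
Proof.
elim: k T a => [|k IHk] T a ori free cl.
  apply: (@colorable_by _ T _ _ id) => [|x y]; last first.
    by apply: contraTneq => ->; rewrite und_irr.
  rewrite leqNgt; apply/card_gt0P => -[x _].
  suff /cl : clique a [set x] by rewrite cards1.
  apply/forall_inP => y /set1P->; apply/forall_inP => z /set1P->.
  by rewrite eqxx.
apply: colorable_step => // z.
apply: (@colorable_sub _ _ (fun x y => [&& und a x z, und a y z & und a x y])) (leqnn _) _ => //.
apply: (@colorable_sig _ (fun x => und a x z) (und a)).
apply: (IHk _ (fun u v : {x | und a x z} => a (val u) (val v))).
- by case: ori => irr asym; split=> [u|u v]; [apply: irr | apply: asym].
- move=> x P Q xP xQ cP cQ st.
  apply: (free (val x) (val @: P) (val @: Q)).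
  + by move=> _ /imsetP[u uP ->]; apply: xP.
  + by move=> _ /imsetP[u uQ ->]; apply: xQ.
  + by rewrite card_imset //; apply: val_inj.
  + by rewrite card_imset //; apply: val_inj.
  move=> y y'; rewrite -imsetU => /imsetP[u uPQ ->] /imsetP[v vPQ ->].
  exact: st.
(* Adding [z] to a clique of its neighbourhood enlarges it by one. *)
move=> S /forall_inP clS; rewrite -ltnS -(card_imset _ val_inj).
have zS : z \notin val @: S.
  by apply/imsetP => -[u _ zu]; have := valP u; rewrite -zu und_irr.
suff /cl : clique a (z |: val @: S) by rewrite cardsU1 zS.
apply/forall_inP => x xS; apply/forall_inP => y yS; apply/implyP.
move: xS yS => /setU1P[->|/imsetP[u uS ->]] /setU1P[->|/imsetP[v vS ->]].
- by rewrite eqxx.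
- by rewrite und_sym (valP v).
- by rewrite (valP u).
by have /forall_inP/(_ v vS)/implyP := clS u uS; rewrite (inj_eq val_inj).
Qed.

(** * Back to [chi] and to induced stars *)

Lemma colorable_chi (T : finType) (a : rel T) (k : nat) :
  colorable (und a) k -> chi a <= k.
Proof.
move=> [c cP]; rewrite /chi; set p := fun _ => _.
have pk : p k.
  apply/existsP; exists [ffun x => c x]; apply/forallP => x; apply/forallP => y.
  by apply/implyP => xy; rewrite !ffunE cP.
(* The search in [chi] stops at [#|T|]; for larger [k] the length of the list is bound enough. *)
case: (leqP k #|T|) => [le_kT|lt_Tk].
  rewrite leqNgt; apply/negP => /(before_find 0).
  by rewrite nth_iota ?add0n ?pk // ltnS.
by apply: leq_trans (find_size _ _) _; rewrite size_iota.
Qed.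

Lemma oriented_star_center (TH : finType) (aH : rel TH) :
  oriented_star aH -> exists c : TH, forall x y, und aH x y = ((x == c) != (y == c)).
Proof.
move=> [_ [n [phi [phi_bij undP]]]]; have [psi phiK psiK] := phi_bij.
exists (psi None) => x y; rewrite undP -!(can2_eq phiK psiK).
by case: (phi x) (phi y) => [i|] [j|].
Qed.

(** With [#|TH|] vertices on each side, leaves are placed by their rank in [TH], without counting
    in-leaves and out-leaves separately. *)
Lemma star_free_induced (TH T : finType) (aH : rel TH) (a : rel T) :
  oriented_star aH -> oriented a -> ~ induced_sub aH a -> star_free a #|TH|.
Proof.
move=> starH ori free x P Q xP xQ cP cQ st; apply: free.
have [c cenH] := oriented_star_center starH; have [[irrH asymH] _] := starH.
pose leaf (S : {set T}) (u : TH) := nth x (enum S) (enum_rank u).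
have leaf_in (S : {set T}) u : #|TH| <= #|S| -> leaf S u \in S.
  move=> cS; rewrite -mem_enum mem_nth // -cardE.
  exact: leq_trans (ltn_ord _) cS.
have leaf_inj (S : {set T}) u v : #|TH| <= #|S| -> leaf S u = leaf S v -> u = v.
  move=> cS /eqP; rewrite nth_uniq ?enum_uniq -?cardE ?(leq_trans (ltn_ord _) cS) //.
  by move=> /eqP/val_inj/enum_rank_inj.
have PQ y : y \in P -> y \in Q -> False.
  by move=> /xP xy /xQ yx; have := ori.2 _ _ xy; rewrite yx.
have xnP : x \notin P by apply/negP => /xP; apply/negP/ori.1.
have xnQ : x \notin Q by apply/negP => /xQ; apply/negP/ori.1.
pose h u := if u == c then x else if aH c u then leaf P u else leaf Q u.
have hP u : u != c -> aH c u -> h u \in P.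
  by rewrite /h => /negPf-> ->; apply: leaf_in.
have hQ u : u != c -> ~~ aH c u -> h u \in Q.
  by rewrite /h => /negPf-> /negPf->; apply: leaf_in.
have hPQ u : u != c -> h u \in P :|: Q.
  by move=> uc; rewrite inE; case: (boolP (aH c u)) => cu; [rewrite hP | rewrite orbC hQ].
exists h; split.
  move=> u v; rewrite /h; case: (eqVneq u c) => [->|uc]; case: (eqVneq v c) => [->|vc] //=.
  - by case: (aH c v) => e; [move: xnP | move: xnQ]; rewrite e leaf_in.
  - by case: (aH c u) => e; [move: xnP | move: xnQ]; rewrite -e leaf_in.
  case: (aH c u); case: (aH c v) => e.
  - exact: leaf_inj e.
  - by case: (PQ (leaf P u)); rewrite ?leaf_in // e leaf_in.
  - by case: (PQ (leaf Q u)); rewrite ?leaf_in // e leaf_in.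
  - exact: leaf_inj e.
have hc : h c = x by rewrite /h eqxx.
have centerL u : u != c -> a x (h u) = aH c u.
  move=> uc; case: (boolP (aH c u)) => cu; first by rewrite xP ?hP.
  by apply/negbTE/ori.2/xQ/hQ.
have centerR u : u != c -> a (h u) x = aH u c.
  move=> uc; have /orP[cu|uc'] : aH c u || aH u c.
    by have := cenH c u; rewrite /und eqxx (negPf uc).
  - by rewrite (negPf (asymH _ _ cu)); apply/negbTE/ori.2/xP/hP.
  - by rewrite uc' xQ // hQ // asymH.
move=> u v; case: (eqVneq u c) => [->|uc]; case: (eqVneq v c) => [->|vc].
- by rewrite hc (negPf (ori.1 x)) (negPf (irrH c)).
- by rewrite hc centerL.
- by rewrite hc centerR.
have := st _ _ (hPQ u uc) (hPQ v vc); rewrite negb_or => /andP[/negPf-> _].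
by have := cenH u v; rewrite (negPf uc) (negPf vc) eqxx => /negbT/norP[/negPf-> _].
Qed.

Theorem theorem1p2 (TH : finType) (aH : rel TH) :
  oriented_star aH ->
  exists f : nat -> nat,
    forall (T : finType) (a : rel T),
      oriented a -> ~ induced_sub aH a -> chi a <= f (omega a).
Proof.
move=> starH; exists (star_chi_bound #|TH|) => T a ori free.
apply/colorable_chi/colorable_star_free => //; first exact: (star_free_induced starH).
by move=> S clS; apply: (@leq_bigmax_cond _ (clique a) (fun S : {set T} => #|S|)).
Qed.
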